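(* Let $\mathcal{H}$ be a real Hilbert space and let $f:\mathcal{H}\to\mathbb{R}$ be a continuously differentiable convex function with $\operatorname{argmin}_{\mathcal{H}} f\neq\emptyset$. Put $f^\star=\min_{\mathcal{H}} f$ and let $t_0\ge 0$. Then, for any bounded solution $x:[t_0,+\infty[\,\to\mathcal{H}$ of the differential equation $$\ddot{x}(t)+\sqrt{E(t)}\,\dot{x}(t)+\nabla f(x(t))=0,\qquad E(t)=f(x(t))-f^\star+\tfrac12\|\dot{x}(t)\|^2,$$ and for any $\delta>0$, $$f(x(t))-f^\star=o\left(\frac{1}{t^{2-\delta}}\right)\quad\text{as } t\to+\infty .$$
   Context: A (global) solution of the differential equation is a function $x:[t_0,+\infty[\,\to\mathcal{H}$ that is continuously differentiable on $[t_0,+\infty[$, twice continuously differentiable on $]t_0,+\infty[$, and satisfies the equation for all $t>t_0$ (its initial data are $x(t_0)=x_0\in\mathcal{H}$ and $\dot{x}(t_0)=\dot{x}_0\in\mathcal{H}$). It is bounded if $\sup_{t\ge t_0}\|x(t)\|<+\infty$. For a non-negative function $g$, $g(t)=o(1/t^{\alpha})$ means $\lim_{t\to+\infty}t^{\alpha}g(t)=0$. *)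

(* Defs.v *)
From HB Require Import structures.
From mathcomp Require Export all_boot all_order all_algebra.
From mathcomp Require Export all_classical all_reals all_analysis.
Export Order.TTheory GRing.Theory Num.Theory.
Export numFieldNormedType.Exports.

Set Implicit Arguments.
Unset Strict Implicit.
Unset Printing Implicit Defensive.

Global Open Scope ring_scope.
Global Open Scope classical_set_scope.

(* A real Hilbert space is a complete normed module H over R : realType with an
   inner product ip : {dot H for idfun} such that [induces_norm ip]. *)
Definition induces_norm (R : realType) (H : normedModType R)
    (ip : {dot H for @idfun R}) : Prop :=
  forall u : H, `|u| = Num.sqrt (ip u u).

(* Frechet differentiability everywhere, with u |-> 'd f u continuous for the
   operator norm. *)
Definition continuously_differentiable (R : realType) (H : normedModType R)
    (f : H -> R) : Prop :=
  (forall u : H, differentiable f u) /\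
  (forall (u : H) (e : R), 0 < e ->
    \forall w \near u, forall h : H, `|'d f w h - 'd f u h| <= e * `|h|).

(* The representative of 'd f u for the inner product. When f is differentiable
   at u and H is complete, it exists and is unique (Riesz), and the default
   value 0 plays no role. *)
Definition gradient (R : realType) (H : normedModType R)
    (ip : {dot H for @idfun R}) (f : H -> R) (u : H) : H :=
  xget 0 [set g : H | forall h : H, 'd f u h = ip g h].

Definition argmin (R : realType) (T : Type) (f : T -> R) : set T :=
  [set z | forall y, f z <= f y].

(* The minimum of f, as soon as [argmin f] is nonempty. *)
Definition minval (R : realType) (T : Type) (f : T -> R) : R := inf (range f).

(* Functions on [t0, +oo[ are represented by total functions on R, whose values
   on ]-oo, t0[ are irrelevant: the derivative at t0 is one-sided. *)
Definition C1_itvcy (R : realType) (H : normedModType R) (t0 : R)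
    (x : R -> H) : Prop :=
  exists v : R -> H,
    [/\ forall t : R, t0 < t -> is_derive t 1 x (v t),
        h^-1 *: (x (t0 + h) - x t0) @[h --> (0 : R)^'+] --> v t0 &
        {within `[t0, +oo[%classic, continuous v}].

Definition C2_itvoy (R : realType) (H : normedModType R) (t0 : R)
    (x : R -> H) : Prop :=
  forall t : R, t0 < t ->
    [/\ derivable x t 1, derivable x^`() t 1 & {for t, continuous x^`(2)}].

Definition energy (R : realType) (H : normedModType R) (f : H -> R)
    (x : R -> H) (t : R) : R :=
  f (x t) - minval f + 2^-1 * `|x^`() t| ^+ 2.

Definition is_solution (R : realType) (H : normedModType R)
    (ip : {dot H for @idfun R}) (f : H -> R) (t0 : R) (x : R -> H) : Prop :=
  [/\ C1_itvcy t0 x, C2_itvoy t0 x &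
      forall t : R, t0 < t ->
        x^`(2)%classic t + Num.sqrt (energy f x t) *: x^`()%classic t
          + gradient ip f (x t) = 0].

(* Main.v *)
Require Import Defs.
From mathcomp Require Import ring lra.

Set Implicit Arguments.
Unset Strict Implicit.
Unset Printing Implicit Defensive.

(** The energy satisfies E' = - sqrt E * |x'|^2. The damping coefficient
    g = sqrt E therefore has derivative g' = - |x'|^2 / 2, so that the kinetic
    term |x'|^2 = - 2 g' is itself an exact derivative. This is what makes the
    closed-loop damping tractable.

    Let z be a minimizer of f and h = |x - z|^2 / 2. The equation and the
    tangent inequality f z >= f x + <grad f x, z - x> give
      g^2 + 3 g' + g h' + h'' <= 0,
    where |h'| <= C g because the trajectory is bounded and |x'|^2 <= 2 E.
    For 0 < e <= 1, weighting this inequality by g^(e - 1) and absorbing the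
    remaining cross term, the function
      V = g^e ((3 + C) / e + h) + g^(e - 1) h'
    is nonnegative and satisfies V' <= - g^(1 + e) ([lyapunov_decay]). As g is
    nonincreasing, (t - t1) g(t)^(1 + e) <= V(t1): this is
    E = O(t^(- 2 / (1 + e))) for every e in ]0, 1], and e small compared with
    delta gives the o(t^(- (2 - delta))) rate ([rate_of_power_decay]). If the
    energy vanishes at some time, it vanishes from then on by monotonicity and
    there is nothing to do; otherwise g is positive and differentiable
    throughout.

    Since [gradient] is obtained by choice, the identity
    f'(u) h = <grad f u, h> rests on the Riesz representation theorem ([riesz]),
    which is proved here by minimizing h |-> |h|^2 - 2 L h. *)

(** * Inner product *)

Section InnerProduct.
Context (R : realType) (H : normedModType R) (ip : {dot H for @idfun R}).
Hypothesis ip_norm : induces_norm ip.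
Implicit Types (u v w : H) (a : R).

Lemma ipC u v : ip u v = ip v u.
Proof. by rewrite hermC /= expr0 mul1r. Qed.

Lemma ipDl u v w : ip (u + v) w = ip u w + ip v w.
Proof. exact: linearDl. Qed.

Lemma ipDr u v w : ip w (u + v) = ip w u + ip w v.
Proof. by rewrite ipC ipDl !(ipC w). Qed.

Lemma ipZl a u v : ip (a *: u) v = a * ip u v.
Proof. exact: linearZl_LR. Qed.

Lemma ipZr a u v : ip u (a *: v) = a * ip u v.
Proof. by rewrite ipC ipZl ipC. Qed.

Lemma ipNl u v : ip (- u) v = - ip u v.
Proof. by rewrite -scaleN1r ipZl mulN1r. Qed.

Lemma ipNr u v : ip u (- v) = - ip u v.
Proof. by rewrite ipC ipNl ipC. Qed.

Lemma ipuu u : ip u u = `|u| ^+ 2.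
Proof.
have uu_ge0 : 0 <= ip u u.
  have [->|u0] := eqVneq u 0; first by rewrite linear0l.
  exact/ltW/neq0_dnorm_gt0.
by rewrite ip_norm sqr_sqrtr.
Qed.

Lemma normDsq u v : `|u + v| ^+ 2 = `|u| ^+ 2 + 2 * ip u v + `|v| ^+ 2.
Proof. by rewrite -!ipuu ipDl !ipDr (ipC v u); ring. Qed.

(** The triangle inequality of the norm, once squared, is the Cauchy-Schwarz
    inequality for the form that induces it. *)
Lemma cauchy_schwarz u v : `|ip u v| <= `|u| * `|v|.
Proof.
have ip_le w : ip u w <= `|u| * `|w|.
  have : `|u + w| ^+ 2 <= (`|u| + `|w|) ^+ 2.
    by rewrite ler_pXn2r ?nnegrE ?addr_ge0// ler_normD.
  by rewrite normDsq; lra.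
by rewrite ler_norml ip_le andbT lerNl -ipNr -(normrN v) ip_le.
Qed.

(** By polarization, joint continuity of the form reduces to that of the
    norm. *)
Lemma cvg_ip (T : Type) (F : set_system T) {FF : Filter F}
    (u_ v_ : T -> H) u v :
  u_ @ F --> u -> v_ @ F --> v -> ip (u_ t) (v_ t) @[t --> F] --> ip u v.
Proof.
have ipE y z : ip y z = 2^-1 * (`|y + z| ^+ 2 - `|y| ^+ 2 - `|z| ^+ 2).
  by rewrite normDsq; field.
move=> uu vv; rewrite ipE; under eq_fun do rewrite ipE.
apply: cvgMr; apply: cvgB; first apply: cvgB.
- by rewrite expr2; apply: cvgM; apply: cvg_norm; apply: cvgD.
- by rewrite expr2; apply: cvgM; apply: cvg_norm.
- by rewrite expr2; apply: cvgM; apply: cvg_norm.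
Qed.

Lemma is_derive_ip (u_ v_ : R -> H) (t : R) u' v' :
  is_derive t 1 u_ u' -> is_derive t 1 v_ v' ->
  is_derive t 1 (fun s => ip (u_ s) (v_ s)) (ip u' (v_ t) + ip (u_ t) v').
Proof.
move=> [du Du] [dv Dv].
have vc : v_ (h *: (1 : R) + t) @[h --> 0^'] --> v_ t.
  suff : {for 0, continuous (fun h : R => v_ (h *: 1 + t))}.
    by move=> /continuous_withinNx; rewrite scale0r add0r.
  exact/differentiable_continuous/derivable1_diffP/(derivable1P _ _ _).1.
have cv : h^-1 *: (((fun s => ip (u_ s) (v_ s)) \o shift t) (h *: 1)
    - ip (u_ t) (v_ t)) @[h --> 0^'] --> ip u' (v_ t) + ip (u_ t) v'.
  rewrite -Du -Dv.
  apply: cvg_trans (cvgD (cvg_ip du vc) (cvg_ip (cvg_cst (u_ t)) dv)).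
  apply/near_eq_cvg/nearW => h /=.
  rewrite fctE ipZl ipZr -mulrDr; congr (_ * _).
  by rewrite ipDl ipDr ipNl ipNr; ring.
split; last exact: (cvg_lim _ cv).
by apply/cvg_ex; exists (ip u' (v_ t) + ip (u_ t) v').
Qed.

End InnerProduct.

(** * Riesz representation, gradient and tangent inequality *)

(** The representative is the minimizer of phi h = |h|^2 - 2 L h. It exists
    because the parallelogram identity makes the sublevel sets of phi near its
    infimum a Cauchy filter base, and varying phi along the lines through the
    minimizer shows that it represents L. *)
Lemma riesz (R : realType) (H : completeNormedModType R)
    (ip : {dot H for @idfun R}) (ip_norm : induces_norm ip)
    (L : {linear H -> R}) :
  continuous L -> exists g, forall h, L h = ip g h.
Proof.
move=> Lc; have [k k0 Lk] := linear_lipschitz Lc.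
pose phi h := `|h| ^+ 2 - 2 * L h; pose m := inf (range phi).
have phi_inf : has_inf (range phi).
  split; first by exists (phi 0), 0.
  exists (- k ^+ 2) => _ [h _ <-]; rewrite /phi.
  have := Lk h; have := ler_norm (L h); have := sqr_ge0 (`|h| - k); lra.
have m_le h : m <= phi h.
  by apply: ge_inf; [exact: phi_inf.2|exists h].
have LD u v : L (u + v) = L u + L v by exact: linearD.
have LZ a u : L (a *: u) = a * L u by exact: linearZ.
pose F := filter_from [set e : R | 0 < e] (fun e => [set h | phi h < m + e]).
have FF : ProperFilter F.
  apply: filter_from_proper; last first.
    move=> e e0; have [_ [h _ <-] he] := inf_adherent e0 phi_inf.
    by exists h.
  apply: filter_from_filter; first by exists 1; exact: ltr01.
  move=> e1 e2 /= e10 e20; exists (Order.min e1 e2) => /=.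
    by rewrite lt_min e10.
  move=> h /= he; split; apply: lt_le_trans he _; rewrite lerD2l ge_min lexx//.
  by rewrite orbT.
have parallelogram u v :
    `|u - v| ^+ 2 = 2 * phi u + 2 * phi v - 4 * phi (2^-1 *: (u + v)).
  rewrite /phi LZ LD !normrZ !exprMn ger0_norm//.
  by rewrite !(normDsq ip_norm) normrN ipNr; field.
have Fcvg : cvg F.
  apply: cauchy_cvg; apply/cauchyP => e e0.
  have d0 : 0 < e ^+ 2 / 4 by rewrite divr_gt0 ?exprn_gt0.
  have [_ [u _ <-] ud] := inf_adherent d0 phi_inf.
  exists u; exists (e ^+ 2 / 4) => // v /= vd.
  rewrite -ball_normE /=.
  rewrite -(@ltr_pXn2r _ 2) ?nnegrE// ?(ltW e0)//.
  rewrite parallelogram; have := m_le (2^-1 *: (u + v)).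
  rewrite -/m in ud; lra.
set g := lim F.
have Lg : L h @[h --> F] --> L g by apply: continuous_cvg => //; exact: Lc.
have phig : phi g = m.
  have phiF : phi h @[h --> F] --> phi g.
    apply: cvgB; last by apply: cvgMr.
    by rewrite expr2; apply: cvgM; apply: cvg_norm.
  apply: (cvg_unique _ phiF) => //.
  apply/cvgrPdist_lt => e e0; exists e => // h /= he.
  rewrite distrC ltr_norml; have := m_le h; lra.
exists g => h; set d := ip g h - L h.
have vari a : 0 <= 2 * a * d + a ^+ 2 * `|h| ^+ 2.
  have := m_le (g + a *: h); rewrite -phig /phi LD LZ (normDsq ip_norm) ipZr.
  rewrite normrZ exprMn real_normK ?num_real// /d; lra.
(* For the step a = - s d below, the first-order term of the variation is
   - 2 s d^2 and the second-order one is at most s d^2. *)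
have N1_gt0 : 0 < `|h| ^+ 2 + 1 by rewrite ltr_wpDl ?sqr_ge0.
pose s := (`|h| ^+ 2 + 1)^-1.
have s0 : 0 < s by rewrite invr_gt0.
have sN : s * `|h| ^+ 2 <= 1 by rewrite mulrC ler_pdivrMr// mul1r lerDl.
have sd := vari (- (s * d)).
have sd2 : 0 <= s * d ^+ 2 by rewrite mulr_ge0 ?sqr_ge0 ?ltW.
have : s * d ^+ 2 <= 0.
  have : s * d ^+ 2 * (s * `|h| ^+ 2) <= s * d ^+ 2 by rewrite ler_piMr.
  by lra.
rewrite pmulr_rle0// exprn_even_le0//= => /eqP; rewrite /d; lra.
Qed.

Lemma gradientP (R : realType) (H : completeNormedModType R)
    (ip : {dot H for @idfun R}) (ip_norm : induces_norm ip)
    (f : H -> R) (u h : H) :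
  differentiable f u -> 'd f u h = ip (gradient ip f u) h.
Proof.
move=> df; rewrite /gradient.
have [|g Lg] := riesz ip_norm (L := 'd f u).
  exact: diff_continuous.
have : exists g, [set g | forall h : H, 'd f u h = ip g h] g by exists g.
by move=> /(xgetPex 0); apply.
Qed.

Lemma is_derive_comp_diff (R : realType) (V W : normedModType R) (f : V -> W)
    (x : R -> V) (t : R) (v : V) :
  differentiable f (x t) -> is_derive t 1 x v ->
  is_derive t 1 (fun s => f (x s)) ('d f (x t) v).
Proof.
move=> df [dx xv].
have dx' : differentiable x t by exact/derivable1_diffP.
have dfx : differentiable (f \o x) t by exact: differentiable_comp.
split; first exact: diff_derivable.
by rewrite deriveE// diff_comp//= -xv deriveE.
Qed.

(** The difference quotients of f at u towards z, of step h in ]0, 1], are at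
    most f z - f u by convexity; their limit is the directional derivative. *)
Lemma convex_tangent_le (R : realType) (H : normedModType R) (f : H -> R)
    (u z : H) :
  convex_function [set: convex_lmodType H] f -> differentiable f u ->
  f u + 'd f u (z - u) <= f z.
Proof.
move=> fconv df; rewrite -lerBrDl -deriveE//.
have der := @diff_derivable _ _ _ _ _ (z - u) df.
rewrite /derive cvg_at_rightE//; apply: limr_le.
  by apply/cvg_ex; exists ('D_(z - u) f u); apply: cvg_dnbhs_at_right.
near=> h; have h0 : 0 < h by [].
have h1 : h <= 1 by near: h; exact: nbhs_right_le.
rewrite /= -ler_pdivlMl ?invr_gt0// invrK.
have := fconv (Itv01 (ltW h0) h1) z u; rewrite !inE => /(_ I I) /=.
rewrite convRE /conv /= /unstable.onem.
have -> : h *: z + (1 - h) *: u = h *: (z - u) + u.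
  by rewrite scalerBl scalerBr scale1r addrCA addrC.
lra.
Unshelve. all: by end_near. Qed.

(** * Lyapunov decay of the damping coefficient *)

Lemma is_derive_le0_nincr (R : realType) (F dF : R -> R) (a b : R) : a <= b ->
  (forall s, a <= s <= b -> is_derive s 1 F (dF s)) ->
  (forall s, a <= s <= b -> dF s <= 0) -> F b <= F a.
Proof.
move=> ab dFP dF0.
have sub s : s \in `]a, b[%R -> a <= s <= b.
  by rewrite in_itv/= => /andP[/ltW-> /ltW->].
have [||c] := @MVT_segment R F dF a b ab.
- by move=> s /sub; exact: dFP.
- apply: derivable_within_continuous => s; rewrite in_itv/= => /dFP[dFs _].
  exact: dFs.
rewrite in_itv/= => cab FE; rewrite -subr_le0 FE.
by rewrite mulr_le0_ge0 ?dF0// subr_ge0.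
Qed.

Section Decay.
Context (R : realType) (t0 C : R) (g g' h h' h'' : R -> R).
Hypothesis g_gt0 : forall t, t0 < t -> 0 < g t.
Hypothesis dg : forall t, t0 < t -> is_derive t 1 g (g' t).
Hypothesis dh : forall t, t0 < t -> is_derive t 1 h (h' t).
Hypothesis dh' : forall t, t0 < t -> is_derive t 1 h' (h'' t).
Hypothesis g'_le0 : forall t, t0 < t -> g' t <= 0.
Hypothesis h_ge0 : forall t, t0 < t -> 0 <= h t.
Hypothesis h'_le : forall t, t0 < t -> `|h' t| <= C * g t.
Hypothesis ineq : forall t, t0 < t ->
  g t ^+ 2 + 3 * g' t + g t * h' t + h'' t <= 0.

(** Multiplied by g^(e - 1), the inequality [ineq] bounds by - g^(1 + e) the
    derivative of 3 / e * g^e + g^e h + g^(e - 1) h', except for two terms that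
    this derivative has in excess: e g^(e - 1) g' h, which is nonpositive, and
    the cross term (e - 1) g^(e - 2) g' h'. The bound on h' controls the latter
    by (1 - e) C g^(e - 1) |g'|, which the summand C / e * g^e of V absorbs as
    g' <= 0; the same summand makes V nonnegative. *)
Lemma lyapunov_decay (e t1 : R) : 0 < e <= 1 -> t0 < t1 ->
  exists B, forall t, t1 <= t -> (t - t1) * g t `^ (1 + e) <= B.
Proof.
move=> /andP[e0 e1] t01.
pose V t := g t `^ e * ((3 + C) / e + h t) + g t `^ (e - 1) * h' t.
exists (V t1) => t t1t.
have t0t : t0 < t by exact: lt_le_trans t1t.
have gE (s : R) : t0 < s -> g s `^ e = g s `^ (e - 1) * g s.
  by move=> /g_gt0 gs; rewrite mulrC mulr_powRB1 ?ltW.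
have V_ge0 : 0 <= V t.
  have P0 := powR_gt0 (e - 1) (g_gt0 t0t); rewrite /V gE// -mulrA -mulrDr.
  apply: mulr_ge0; first exact: ltW.
  have := h'_le t0t; rewrite ler_norml => /andP[Ch' _].
  have Cg : C * g t <= g t * (C / e).
    rewrite mulrC ler_pM2l ?g_gt0// ler_pdivlMr//.
    have : 0 <= C * g t by rewrite (le_trans _ (h'_le t0t)).
    rewrite pmulr_lge0 ?g_gt0// => C0.
    by rewrite ler_piMr.
  have gh : 0 <= g t * h t by rewrite mulr_ge0 ?h_ge0 ?ltW ?g_gt0.
  have ge : 0 <= g t * (3 / e) by rewrite mulr_ge0 ?divr_ge0 ?ltW ?g_gt0.
  rewrite mulrDl; lra.
have ge_ge0 : 0 <= g t `^ (1 + e) by exact: powR_ge0.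
(* As g is nonincreasing, V' <= - g^(1 + e) is at most the constant
   - g(t)^(1 + e) on [t1, t]: W is nonincreasing there, without integration. *)
pose W s := V s + g t `^ (1 + e) * (s - t1).
suff : W t <= W t1 by rewrite /W subrr mulr0 addr0; lra.
pose dW s :=
  (g s `^ e * h' s + ((3 + C) / e + h s) * ((e * g s `^ (e - 1)) * g' s))
   + (g s `^ (e - 1) * h'' s + h' s * (((e - 1) * g s `^ (e - 1 - 1)) * g' s))
   + g t `^ (1 + e).
apply: (@is_derive_le0_nincr _ _ dW) => // s /andP[t1s st].
- have t0s : t0 < s by exact: lt_le_trans t1s.
  have gs := g_gt0 t0s; have := dg t0s; have := dh t0s; have := dh' t0s.
  move=> dh's dhs dgs.
  have p1 := is_derive1_comp (is_derive1_powR e gs) dgs.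
  have p2 := is_derive1_comp (is_derive1_powR (e - 1) gs) dgs.
  rewrite /W /V.
  apply: is_derive_eq; rewrite /dW /GRing.scale/= !(subr0, add0r, mulr1); ring.
- have t0s : t0 < s by exact: lt_le_trans t1s.
  have gs := g_gt0 t0s.
  have gs0 : g s != 0 by rewrite gt_eqF.
  have dWE : dW s = g s `^ (e - 1) *
      ((3 + C + e * h s) * g' s + g s * h' s + h'' s
       + (1 - e) * (- g' s * h' s / g s)) + g t `^ (1 + e).
    rewrite /dW gE//.
    have -> : g s `^ (e - 1 - 1) = g s `^ (e - 1) / g s.
      by rewrite (@powRB _ _ (e - 1) 1) ?gs0 ?implybT// powRr1// ltW.
    by field; rewrite !gt_eqF.
  have gle : g t `^ (1 + e) <= g s `^ (e - 1) * g s ^+ 2.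
    have -> : g s `^ (e - 1) * g s ^+ 2 = g s `^ (1 + e).
      rewrite expr2 mulrA -gE// addrC powRD ?powRr1 ?(ltW gs)//.
      by rewrite gs0 implybT.
    apply: ge0_ler_powR.
    - by rewrite addr_ge0// ltW.
    - by rewrite nnegrE ltW// g_gt0.
    - by rewrite nnegrE ltW.
    apply: (@is_derive_le0_nincr _ _ g') => // r /andP[sr rt].
      exact/dg/(lt_le_trans t0s).
    exact/g'_le0/(lt_le_trans t0s).
  have cross : - g' s * h' s / g s <= - g' s * C.
    rewrite ler_pdivrMr// -mulrA ler_wpM2l ?oppr_ge0 ?g'_le0//.
    exact: le_trans (ler_norm _) (h'_le t0s).
  rewrite dWE.
  have I := ineq t0s.
  have C_ge0 : 0 <= C.
    by rewrite -(pmulr_lge0 _ gs) (le_trans _ (h'_le t0s)).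
  have P0 := powR_gt0 (e - 1) gs.
  have gs'0 := g'_le0 t0s; have hs0 := h_ge0 t0s.
  suff : (3 + C + e * h s) * g' s + g s * h' s + h'' s
      + (1 - e) * (- g' s * h' s / g s) <= - g s ^+ 2.
    rewrite -(ler_pM2l P0); lra.
  have cross_le : (1 - e) * (- g' s * h' s / g s) <= (1 - e) * (- g' s * C).
    by rewrite ler_wpM2l ?subr_ge0.
  have gh_le0 : e * h s * g' s <= 0 by rewrite mulr_ge0_le0// mulr_ge0// ltW.
  have gC_le0 : e * (g' s * C) <= 0 by rewrite mulr_ge0_le0 ?mulr_le0_ge0// ltW.
  lra.
Qed.
End Decay.

(** * From power decay to the rate *)

Lemma powRN_cvg0 (R : realType) (r : R) :
  0 < r -> t `^ (- r) @[t --> +oo] --> (0 : R).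
Proof.
move=> r0.
apply/cvgr0Pnorm_lt => e e0; near=> t.
rewrite ger0_norm ?powR_ge0// powRN invf_plt ?posrE ?powR_gt0//.
rewrite -[ltLHS]powRr1 ?invr_ge0 ?ltW// -(mulVf (lt0r_neq0 r0)) powRrM.
apply: gt0_ltr_powR => //; rewrite ?nnegrE ?powR_ge0//.
Unshelve. all: by end_near. Qed.

(** With q = 2 / (1 + e), the hypothesis reads g^2 = (g^(1 + e))^q = O(t^(- q)),
    and q > 2 - delta as soon as e is small enough. *)
Lemma rate_of_power_decay (R : realType) (g : R -> R) :
  (forall t, 0 <= g t) ->
  (forall e, 0 < e <= 1 -> exists t1 B, forall t, t1 <= t ->
    (t - t1) * g t `^ (1 + e) <= B) ->
  forall delta, 0 < delta ->
    t `^ (2 - delta) * g t ^+ 2 @[t --> +oo] --> (0 : R).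
Proof.
move=> g_ge0 gdecay delta delta0.
(* 2 e < delta gives (2 - delta) (1 + e) < 2, i.e. 2 - delta < q. *)
pose e : R := Order.min 1 (delta / 4).
have e0 : 0 < e by rewrite lt_min ltr01 divr_gt0.
have e1 : e <= 1 by rewrite ge_min lexx.
have ed : e <= delta / 4 by rewrite ge_min lexx orbT.
have [|t1 [B gB]] := gdecay e; first by rewrite e0.
pose q := 2 / (1 + e).
have e10 : 0 < 1 + e by rewrite addr_gt0.
have q0 : 0 < q by rewrite divr_gt0.
have qd : 0 < q + delta - 2.
  rewrite -(pmulr_rgt0 _ e10) mulrBr mulrDr /q mulrCA divff ?gt_eqF// mulr1.
  have : 0 < e * delta by rewrite mulr_gt0.
  lra.
have lim0 : (2 * B) `^ q * t `^ (- (q + delta - 2)) @[t --> +oo] --> (0 : R).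
  rewrite -[X in _ --> X](mulr0 ((2 * B) `^ q)).
  by apply: cvgMr; exact: powRN_cvg0.
apply: (squeeze_cvgr _ (cvg_cst 0) lim0).
near=> t; rewrite mulr_ge0 ?powR_ge0 ?sqr_ge0//=.
have t_gt0 : 0 < t by near: t; exact: nbhs_pinfty_gt.
have t1t : t1 <= t by near: t; apply: nbhs_pinfty_ge; exact: num_real.
(* This gives t / 2 <= t - t1. *)
have t2 : 2 * t1 <= t by near: t; apply: nbhs_pinfty_ge; exact: num_real.
have P0 : 0 <= g t `^ (1 + e) by exact: powR_ge0.
have tP : t * g t `^ (1 + e) <= 2 * B.
  have : (t / 2) * g t `^ (1 + e) <= (t - t1) * g t `^ (1 + e).
    by rewrite ler_wpM2r//; lra.
  have := gB t t1t; lra.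
have -> : g t ^+ 2 = (g t `^ (1 + e)) `^ q.
  by rewrite -powRrM /q mulrCA divff ?gt_eqF// mulr1 powR_mulrn.
have -> : t `^ (2 - delta) = t `^ q * t `^ (- (q + delta - 2)).
  by rewrite -powRD ?(gt_eqF t_gt0) ?implybT//; congr powR; ring.
rewrite mulrAC ler_wpM2r ?powR_ge0// -powRM ?(ltW t_gt0)//.
have tP0 : 0 <= t * g t `^ (1 + e) by rewrite mulr_ge0 ?(ltW t_gt0).
apply: ge0_ler_powR; rewrite ?nnegrE//; first exact: ltW.
exact: le_trans tP.
Unshelve. all: by end_near. Qed.

(** * Energy along a trajectory *)

Lemma minval_argmin (R : realType) (T : Type) (f : T -> R) (z : T) :
  argmin f z -> minval f = f z.
Proof.
move=> fz; apply/eqP; rewrite eq_le; apply/andP; split.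
  by apply: ge_inf; [exists (f z) => _ [y _ <-]; exact: fz|exists z].
by apply: lb_le_inf; [exists (f z), z|move=> _ [y _ <-]; exact: fz].
Qed.

Section Trajectory.
Context (R : realType) (H : completeNormedModType R)
  (ip : {dot H for @idfun R}).
Hypothesis ip_norm : induces_norm ip.
Context (f : H -> R) (z : H).
Hypothesis df : forall u, differentiable f u.
Hypothesis f_convex : convex_function [set: convex_lmodType H] f.
Hypothesis fz : argmin f z.
Context (t0 : R) (x : R -> H).
Hypothesis x_sol : is_solution ip f t0 x.

Local Notation v := (x^`()).
Local Notation a := (x^`(2)).
Local Notation E := (energy f x).
Local Notation g := (fun t => Num.sqrt (E t)).

Lemma is_derive_position t : t0 < t -> is_derive t 1 x (v t).
Proof.
case: x_sol => _ C2 _ /C2[dx _ _]; rewrite derive1E; exact: derivableP.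
Qed.

Lemma is_derive_velocity t : t0 < t -> is_derive t 1 v (a t).
Proof.
case: x_sol => _ C2 _ /C2[_ dv _]; rewrite derive1nS derive1n1 derive1E.
exact: derivableP.
Qed.

Lemma accelerationE t : t0 < t -> a t = - g t *: v t - gradient ip f (x t).
Proof.
case: x_sol => _ _ eqn /eqn; rewrite -addrA => /eqP.
by rewrite addr_eq0 opprD scaleNr => /eqP.
Qed.

Lemma energy_ge_kinetic t : 2^-1 * `|v t| ^+ 2 <= E t.
Proof. by rewrite lerDr subr_ge0 (minval_argmin fz) fz. Qed.

Lemma energy_ge_gap t : f (x t) - minval f <= E t.
Proof. by rewrite lerDl mulr_ge0 ?sqr_ge0. Qed.

Lemma energy_ge0 t : 0 <= E t.
Proof. by rewrite (le_trans _ (energy_ge_kinetic t)) ?mulr_ge0 ?sqr_ge0. Qed.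

Lemma is_derive_energy t : t0 < t -> is_derive t 1 E (- g t * `|v t| ^+ 2).
Proof.
move=> t0t.
have dx := is_derive_position t0t; have dv := is_derive_velocity t0t.
have dfx := is_derive_comp_diff (df (x t)) dx.
have dvv := is_derive_ip ip_norm dv dv.
have -> : E = fun s => f (x s) - minval f + 2^-1 * ip (v s) (v s).
  by apply/funext => s; rewrite (ipuu ip_norm).
apply: is_derive_eq; rewrite (gradientP ip_norm)// accelerationE//.
rewrite !ipDl !ipDr !ipNl !ipNr !ipZl !ipZr (ipuu ip_norm) (ipC ip (v t)).
by rewrite /GRing.scale/=; field.
Qed.

Lemma energy_nincr s t : t0 < s -> s <= t -> E t <= E s.
Proof.
move=> t0s st.
apply: (@is_derive_le0_nincr _ E (fun r => - g r * `|v r| ^+ 2)) => // r.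
move=> /andP[sr _].
exact/is_derive_energy/(lt_le_trans t0s).
Qed.

(** The factor sqrt E of E' cancels against the 1 / (2 sqrt E) of the square
    root: hence the kinetic energy is the derivative of - sqrt E. *)
Lemma is_derive_sqrt_energy t : t0 < t -> 0 < E t ->
  is_derive t 1 g (- (2^-1 * `|v t| ^+ 2)).
Proof.
move=> t0t Et; have dE := is_derive_energy t0t.
apply: is_derive_eq (is_derive1_comp (is_derive1_sqrt Et) dE) _.
by field; rewrite gt_eqF// sqrtr_gt0.
Qed.

(** [lyapunov_decay] for g = sqrt E and h = |x - z|^2 / 2. Its differential
    inequality follows from
    h'' = |x'|^2 - g h' - <x - z, grad f x> <= 3 / 2 |x'|^2 - g h' - E. *)
Lemma energy_decay D : 0 <= D -> (forall t, t0 < t -> `|x t - z| <= D) ->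
  (forall t, t0 < t -> 0 < E t) ->
  forall e t1, 0 < e <= 1 -> t0 < t1 ->
    exists B, forall t, t1 <= t -> (t - t1) * g t `^ (1 + e) <= B.
Proof.
move=> D0 xD E_gt0 e t1 e01 t01.
have gE t : g t ^+ 2 = E t by rewrite sqr_sqrtr ?energy_ge0.
have dxz t : t0 < t -> is_derive t 1 (fun s => x s - z) (v t).
  move=> t0t; have dx := is_derive_position t0t.
  by apply: is_derive_eq; rewrite subr0.
apply: (@lyapunov_decay R t0 (2 * D) g (fun t => - (2^-1 * `|v t| ^+ 2))
   (fun t => 2^-1 * ip (x t - z) (x t - z)) (fun t => ip (x t - z) (v t))
   (fun t => ip (v t) (v t) + ip (x t - z) (a t))) => // t t0t.
- by rewrite sqrtr_gt0 E_gt0.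
- exact: is_derive_sqrt_energy t0t (E_gt0 t t0t).
- have d := is_derive_ip ip_norm (dxz t t0t) (dxz t t0t).
  by apply: is_derive_eq; rewrite (ipC ip _ (v t)) /GRing.scale/=; field.
- exact: (is_derive_ip ip_norm (dxz t t0t) (is_derive_velocity t0t)).
- by rewrite (ipuu ip_norm) mulr_ge0 ?sqr_ge0.
- apply: le_trans (cauchy_schwarz ip_norm _ _) _.
  have vg : `|v t| <= 2 * g t.
    rewrite -(@ler_pXn2r _ 2) ?nnegrE ?mulr_ge0 ?sqrtr_ge0// exprMn gE.
    have := energy_ge_kinetic t; have := energy_ge0 t; lra.
  have -> : 2 * D * g t = D * (2 * g t) by ring.
  by rewrite ler_pM// xD.
- rewrite gE (ipuu ip_norm) accelerationE// ipDr ipNr ipZr.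
  have := convex_tangent_le z f_convex (df (x t)).
  rewrite (gradientP ip_norm)// -opprB ipNr ipC /energy (minval_argmin fz).
  lra.
Qed.
End Trajectory.

Theorem theorem1p1 (R : realType) (H : completeNormedModType R)
  (ip : {dot H for @idfun R}) (ip_norm : induces_norm ip)
  (f : H -> R) (f_C1 : continuously_differentiable f)
  (f_convex : convex_function [set: convex_lmodType H] f)
  (f_argmin : argmin f !=set0)
  (t0 : R) (t0_ge0 : 0 <= t0)
  (x : R -> H) (x_sol : is_solution ip f t0 x)
  (x_bounded : [bounded x t | t in `[t0, +oo[%classic])
  (delta : R) (delta_gt0 : 0 < delta) :
  t `^ (2 - delta) * (f (x t) - minval f) @[t --> +oo] --> (0 : R).
Proof.
have [z fz] := f_argmin; have [df _] := f_C1.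
have E_ge0 := energy_ge0 fz x.
have gE t : Num.sqrt (energy f x t) ^+ 2 = energy f x t by rewrite sqr_sqrtr.
have /pinfty_ex_gt0[M M0 xM] := x_bounded.
have xzM t : t0 < t -> `|x t - z| <= M + `|z|.
  move=> t0t; apply: le_trans (ler_normB _ _) _; rewrite lerD2r xM//=.
  by rewrite in_itv/= ltW.
have lim0 : t `^ (2 - delta) * Num.sqrt (energy f x t) ^+ 2
    @[t --> +oo] --> (0 : R).
  apply: (rate_of_power_decay (g := fun t => Num.sqrt (energy f x t))) => //.
  move=> e e01; have [E_gt0|] :=
    pselect (forall t, t0 < t -> 0 < energy f x t).
    exists (t0 + 1).
    apply: (energy_decay ip_norm df f_convex fz x_sol _ xzM E_gt0 e01).
      by rewrite addr_ge0// ltW.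
    by rewrite ltrDl.
  move=> /existsNP[s /not_implyP[t0s /negP]]; rewrite -leNgt => Es.
  exists s, 0 => t st.
  have -> : energy f x t = 0.
    apply/eqP; rewrite eq_le E_ge0 andbT (le_trans _ Es)//.
    exact: (energy_nincr ip_norm df x_sol).
  rewrite sqrtr0 powR0 ?mulr0// gt_eqF// ltr_wpDl//.
  by case/andP: e01.
apply: (squeeze_cvgr _ (cvg_cst 0) lim0); near=> t.
rewrite gE mulr_ge0 ?powR_ge0//=; last first.
  by rewrite subr_ge0 (minval_argmin fz) fz.
by rewrite ler_wpM2l ?powR_ge0// energy_ge_gap.
Unshelve. all: by end_near. Qed.
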